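(* Let $N$, $\mathfrak n=\bigoplus_{j=1}^{m+1}V_j$, $\mathcal B=\{X_1,\dots,X_p\}$, $L$, $s$, $\ell_1$, $\ell_2$, $\mathcal S=\{Y_1,\dots,Y_n\}$, $r=p-n$, $\mathfrak h$, $H$ and $d\pi_\nu$ be as in the context (in particular $0\le s<m$ and $\ell_i([V_k,V_j])=0$ for $i=1,2$ and all $k,j\ge 2$). Let $\lambda=\lambda_{s+1,\alpha}\ell_1+\lambda_{m+1,\beta}\ell_2$ with $\lambda_{s+1,\alpha},\lambda_{m+1,\beta}$ nonzero real numbers. Then there exist homogeneous polynomials $\tilde p_1,\dots,\tilde p_n,p_1,\dots,p_r$ of degree $s$ and homogeneous polynomials $\tilde q_1,\dots,\tilde q_n,q_1,\dots,q_r$ of degree $m$ on $\mathbb R^n$, all with real coefficients, such that for $f\in C^\infty(\mathbb R^n)$ $$d\pi_\lambda(L)f=\sum_{j=1}^n\Big(\frac{\partial}{\partial t_j}+i\big(\lambda_{s+1,\alpha}\tilde p_j(t)+\lambda_{m+1,\beta}\tilde q_j(t)\big)\Big)^2f-\sum_{k=1}^r\big(\lambda_{m+1,\beta}q_k(t)+\lambda_{s+1,\alpha}p_k(t)\big)^2f.$$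
   Context: Let $N$ be a connected, simply connected nilpotent Lie group whose Lie algebra $\mathfrak n$ (identified with the left-invariant vector fields on $N$) is stratified: $\mathfrak n=\bigoplus_{j=1}^{m+1}V_j$ with finite-dimensional subspaces $V_j$, $m\ge1$, $[V_i,V_j]\subseteq V_{i+j}$ if $i+j\le m+1$, $[V_i,V_j]=0$ if $i+j>m+1$, and $V_1$ generating $\mathfrak n$ as a Lie algebra. Let $\mathcal B=\{X_1,\dots,X_p\}$ be a basis of $V_1$ and $L=\sum_{i=1}^pX_i^2$. Fix an integer $s$ with $0\le s<m$. Fix a basis $\{X_{s+1,j}\}$ of $V_{s+1}$ and an index $\alpha$, and let $\ell_1\in\mathfrak n^*$ be defined by $\ell_1|_{V_i}=0$ for $i\ne s+1$ and $\ell_1(X_{s+1,j})=\delta_{j\alpha}$. Fix a basis $\{X_{m+1,j}\}$ of $V_{m+1}$ and an index $\beta$, and let $\ell_2\in\mathfrak n^*$ be defined by $\ell_2|_{V_i}=0$ for $i\le m$ and $\ell_2(X_{m+1,j})=\delta_{j\beta}$. Assume $\ell_i([V_k,V_j])=0$ for $i=1,2$ and all $k,j\ge2$. Greedy procedure for $\ell\in\mathfrak n^*$: let $P$ initially be the set of unordered pairs $\{X_k,X_j\}\subseteq\mathcal B$ with $\ell([X_k,X_j])\ne0$, and the output set be empty. While some element of $\mathcal B$ lies in at least two pairs of $P$: choose an element lying in the maximal number of pairs of $P$, add it to the output, and delete from $P$ all pairs containing it. When every element lies in at most one pair of $P$, add to the output one arbitrarily chosen element of each remaining pair. (Any admissible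 choices may be made.) Define $\mathcal S_1,\mathcal S_2\subseteq\mathcal B$: if $s\ne1$ and $m\ne1$, $\mathcal S_1=\{X\in\mathcal B:\exists Y\in\mathfrak n,\ \ell_1([X,Y])\ne0\}$ and $\mathcal S_2=\{X\in\mathcal B:\exists Y\in\mathfrak n,\ \ell_2([X,Y])\ne0\}$; if $s=1$, $\mathcal S_1$ is the output of the greedy procedure for $\ell_1$ and $\mathcal S_2$ is as in the previous case; if $m=1$ (so $s=0$), $\mathcal S_1=\emptyset$ and $\mathcal S_2$ is the output of the greedy procedure for $\ell_2$. Let $\mathcal S=\mathcal S_1\cup\mathcal S_2=\{Y_1,\dots,Y_n\}$, $n=\#\mathcal S$, $r=p-n$. Let $W$ be the span of $\mathcal B\setminus\mathcal S$, $\mathfrak h=W\oplus V_2\oplus\cdots\oplus V_{m+1}$ (an ideal of codimension $n$), $H=\exp\mathfrak h$. For $t\in\mathbb R^n$ put $e(t)=\exp(t_1Y_1+\dots+t_nY_n)$; for $a\in N$ let $a_{\mathcal S}\in\mathbb R^n$ be the unique vector with $a\in e(a_{\mathcal S})H$. For an $\mathbb R$-linear map $\nu:\mathfrak n\to\mathbb C$, $a\in N$, $f\in C^\infty(\mathbb R^n)$, set $(\pi_\nu(a)f)(t)=\exp\big(i\,\nu(\log(e(t)\,a\,e(t+a_{\mathcal S})^{-1}))\big)f(t+a_{\mathcal S})$, where $\log$ is the inverse of $\exp$ (for real $\nu$ vanishing on $[\mathfrak h,\mathfrak h]$ this is the representation of $N$ induced from the character $e^{i\nu\circ\log}$ of $H$).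 For $X\in\mathfrak n$ set $d\pi_\nu(X)f=\frac{d}{d\tau}\big|_{\tau=0}\pi_\nu(\exp\tau X)f$, and $d\pi_\nu(L)=\sum_{i=1}^p d\pi_\nu(X_i)^2$. *)

(* Defs.v *)
From HB Require Import structures.
From mathcomp Require Import all_boot all_order all_algebra.
From mathcomp Require Import all_classical all_reals all_analysis.
From mathcomp Require Import complex.
Set Implicit Arguments. Unset Strict Implicit. Unset Printing Implicit Defensive.
Import Order.TTheory GRing.Theory Num.Theory.
Import numFieldNormedType.Exports.
Local Open Scope ring_scope.

Section Complex_helpers.
Variable R : realType.

Definition cRe (z : R[i]) : R := let: Complex a _ := z in a.
Definition cIm (z : R[i]) : R := let: Complex _ b := z in b.

Definition expi (th : R) : R[i] := Complex (cos th) (sin th).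

Definition cderive (g : R -> R[i]) (x : R) : R[i] :=
  Complex (derive1 (fun y => cRe (g y)) x) (derive1 (fun y => cIm (g y)) x).

Definition rC (a : R) : R[i] := Complex a 0.
Definition iC (a : R) : R[i] := Complex 0 a.

Definition partial (n : nat) (j : 'I_n) (f : 'rV[R]_n -> R[i]) (t : 'rV[R]_n) : R[i] :=
  cderive (fun tau => f (t + tau *: delta_mx 0 j)) 0.

Definition smooth (n : nat) (f : 'rV[R]_n -> R[i]) : Prop :=
  forall js : seq 'I_n,
    let g := foldr (@partial n) f js in
    [/\ continuous (fun t => cRe (g t)), continuous (fun t => cIm (g t)) &
       forall t (j : 'I_n),
         derivable (fun tau : R => cRe (g (t + tau *: delta_mx 0 j))) 0 1 /\
         derivable (fun tau : R => cIm (g (t + tau *: delta_mx 0 j))) 0 1].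

Definition homog_poly (n k : nat) (P : 'rV[R]_n -> R) : Prop :=
  exists cf : {ffun 'I_n -> 'I_k.+1} -> R,
    forall t, P t = \sum_(a : {ffun 'I_n -> 'I_k.+1} | (\sum_(j < n) (a j : nat))%N == k)
                      cf a * \prod_(j < n) t 0 j ^+ a j.
End Complex_helpers.

Section Lie.
Variable R : realType.
(** The Lie algebra n is R^d (row vectors); its bracket is given by
    structure constants c i j = [e_i, e_j]. *)
Variable d : nat.
Variable c : 'I_d -> 'I_d -> 'rV[R]_d.

Definition br (x y : 'rV[R]_d) : 'rV[R]_d :=
  \sum_(i < d) \sum_(j < d) (x 0 i * y 0 j) *: c i j.

Definition lie_algebra : Prop :=
  (forall x, br x x = 0) /\
  (forall x y z, br x (br y z) + br y (br z x) + br z (br x y) = 0).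

(** grading: coordinate i has degree deg i; V_j = span of e_i with deg i = j *)
Variable deg : 'I_d -> nat.
Definition inV (j : nat) (x : 'rV[R]_d) : bool :=
  [forall i, (deg i != j) ==> (x 0 i == 0)].

Definition stratified (m : nat) : Prop :=
  [/\ forall i, (1 <= deg i <= m.+1)%N,
      (* [V_a, V_b] <= V_(a+b)  (which is {0} when a+b > m+1) *)
      forall (a b : nat) x y, inV a x -> inV b y -> inV (a + b) (br x y) &
      (* V_1 generates n as a Lie algebra *)
      forall P : 'rV[R]_d -> Prop,
        P 0 -> (forall x y, P x -> P y -> P (x + y)) ->
        (forall (a : R) x, P x -> P (a *: x)) ->
        (forall x y, P x -> P y -> P (br x y)) ->
        (forall x, inV 1 x -> P x) -> forall x, P x].

Definition proj1 (x : 'rV[R]_d) : 'rV[R]_d :=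
  \row_i (if deg i == 1%N then x 0 i else 0).

Definition lf (l x : 'rV[R]_d) : R := \sum_(i < d) x 0 i * l 0 i.

Definition is_basis_of (P : 'rV[R]_d -> bool) (k : nat) (B : 'I_k -> 'rV[R]_d) : Prop :=
  [/\ forall i, P (B i),
      forall a : 'I_k -> R, \sum_(i < k) a i *: B i = 0 -> forall i, a i = 0 &
      forall x, P x -> exists a : 'I_k -> R, x = \sum_(i < k) a i *: B i].

(** Baker-Campbell-Hausdorff product in Dynkin's form, truncated to words of
    length <= K (exact when n is nilpotent of step <= K):
    log(exp X exp Y) = sum_n (-1)^(n-1)/n sum_{r_i+s_i>0}
       [X^r1 Y^s1 ... X^rn Y^sn] / ((sum (r_i+s_i)) prod r_i! s_i!) *)
Fixpoint nest (X Y : 'rV[R]_d) (w : seq bool) : 'rV[R]_d :=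
  match w with
  | [::] => 0
  | a :: w' => if w' is [::] then (if a then X else Y)
               else br (if a then X else Y) (nest X Y w')
  end.

Variable K : nat.
Definition dyn_word k (rs : {ffun 'I_k -> 'I_K.+1 * 'I_K.+1}) : seq bool :=
  flatten [seq nseq (rs i).1 true ++ nseq (rs i).2 false | i <- enum 'I_k].
Definition dyn_tot k (rs : {ffun 'I_k -> 'I_K.+1 * 'I_K.+1}) : nat :=
  (\sum_(i < k) ((rs i).1 + (rs i).2))%N.
Definition dyn_ok k (rs : {ffun 'I_k -> 'I_K.+1 * 'I_K.+1}) : bool :=
  [forall i, (0 < (rs i).1 + (rs i).2)%N] && (dyn_tot rs <= K)%N.

Definition bch (X Y : 'rV[R]_d) : 'rV[R]_d :=
  \sum_(k < K) (((-1) ^+ k / (k.+1)%:R) *: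
     \sum_(rs : {ffun 'I_k.+1 -> 'I_K.+1 * 'I_K.+1} | dyn_ok rs)
        (((dyn_tot rs)%:R * \prod_(i < k.+1) (((rs i).1)`! * ((rs i).2)`!)%:R)^-1
          *: nest X Y (dyn_word rs))).

Variable p : nat.
Variable X : 'I_p -> 'rV[R]_d.

(** Greedy procedure.  A set of unordered pairs is encoded as a symmetric set
    of ordered pairs; cnt P x = number of pairs of P containing x. *)
Definition cnt (P : {set 'I_p * 'I_p}) (x : 'I_p) : nat := #|[set y | (x, y) \in P]|.

Inductive greedy : {set 'I_p * 'I_p} -> {set 'I_p} -> {set 'I_p} -> Prop :=
| greedy_step P O (S : {set 'I_p}) (x : 'I_p) :
    (exists y, 2 <= cnt P y)%N ->
    (forall y, cnt P y <= cnt P x)%N ->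
    greedy [set u in P | (u.1 != x) && (u.2 != x)] (x |: O) S ->
    greedy P O S
| greedy_stop P O (T : {set 'I_p}) :
    (forall y, cnt P y <= 1)%N ->
    (forall x y, (x, y) \in P -> (x \in T) != (y \in T)) ->
    (forall x, x \in T -> exists y, (x, y) \in P) ->
    greedy P O (O :|: T).

Definition greedy_output (l : 'rV[R]_d) (S : {set 'I_p}) : Prop :=
  greedy [set u | lf l (br (X u.1) (X u.2)) != 0] finset.set0 S.

Definition support_set (l : 'rV[R]_d) (S : {set 'I_p}) : Prop :=
  forall k, k \in S <-> exists Y, lf l (br (X k) Y) != 0.

(** the ideal h = span(B \ S) + V_2 + ... + V_(m+1) *)
Variable S : {set 'I_p}.
Definition in_h (x : 'rV[R]_d) : Prop :=
  exists a : 'I_p -> R, proj1 x = \sum_(k < p | k \notin S) a k *: X k.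

Variable n : nat.
Variable Y : 'I_n -> 'I_p.

(** group elements are represented by their logarithms; the product is bch,
    the inverse is negation. e(t) = exp(t_1 Y_1 + ... + t_n Y_n). *)
Definition eS (t : 'rV[R]_n) : 'rV[R]_d := \sum_(j < n) t 0 j *: X (Y j).

(** a_S: the (unique) t with a in e(t) H, i.e. log(e(t)^{-1} a) in h *)
Definition aS (a : 'rV[R]_d) : 'rV[R]_n :=
  match pselect (exists t : 'rV[R]_n, in_h (bch (- eS t) a)) with
  | left h => projT1 (cid h)
  | right _ => 0
  end.

Definition pi (nu : 'rV[R]_d) (a : 'rV[R]_d) (f : 'rV[R]_n -> R[i]) (t : 'rV[R]_n) : R[i] :=
  expi (lf nu (bch (bch (eS t) a) (- eS (t + aS a)))) * f (t + aS a).

Definition dpi (nu : 'rV[R]_d) (Z : 'rV[R]_d) (f : 'rV[R]_n -> R[i]) (t : 'rV[R]_n) : R[i] :=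
  cderive (fun tau => pi nu (tau *: Z) f t) 0.

Definition dpiL (nu : 'rV[R]_d) (f : 'rV[R]_n -> R[i]) (t : 'rV[R]_n) : R[i] :=
  \sum_(i < p) dpi nu (X i) (dpi nu (X i) f) t.
End Lie.

Definition Dphi (R : realType) (n : nat) (j : 'I_n) (phi : 'rV[R]_n -> R)
  (f : 'rV[R]_n -> R[i]) (t : 'rV[R]_n) : R[i] :=
  partial j f t + iC (phi t) * f t.

(* Main.v *)
(* For a = exp(tau X_i) with X_i in V_1, the V_1-component of a BCH product is the sum of the
   V_1-components, so a_S is the vector of S-coordinates of tau X_i and
   pi_nu(a) f (t) = exp(i nu(Phi_i(t, tau))) f(t + a_S) with
   Phi_i(t, tau) = log(e(t) a e(t + a_S)^-1).  Because the bracket respects the grading, every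
   V_k-coordinate of Phi_i is a homogeneous polynomial of degree k in (t, tau), and Phi_i(t, 0) = 0.
   Differentiating at tau = 0 gives d pi_lambda(X_i) = d/dt_j + i phi_i if X_i = Y_j and
   d pi_lambda(X_i) = i phi_i if X_i is not in S, where phi_i = lambda_1 p_i + lambda_2 q_i and
   p_i, q_i, the tau-derivatives at 0 of l_1(Phi_i) and l_2(Phi_i), are homogeneous of degrees s
   and m.  Squaring and summing over i gives the formula. *)

Require Import Defs.
From mathcomp Require Import all_boot all_order all_algebra.
From mathcomp Require Import all_classical all_reals all_analysis.
From mathcomp Require Import complex.
From mathcomp Require Import ring zify.
Import Order.TTheory GRing.Theory Num.Theory.
Set Implicit Arguments. Unset Strict Implicit. Unset Printing Implicit Defensive.
Local Open Scope ring_scope.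

Lemma prod_count_mem (R : comPzSemiRingType) (I : finType) (f : I -> R) (vs : seq I) :
  \prod_(v <- vs) f v = \prod_j f j ^+ count_mem j vs.
Proof.
elim: vs => [|v vs IH]; first by rewrite big_nil big1 // => j _; rewrite expr0.
under [RHS]eq_bigr => j _ do rewrite /= exprD.
rewrite big_cons big_split /= IH; congr (_ * _).
rewrite (bigD1 v) //= eqxx expr1 big1 ?mulr1 // => j hj.
by rewrite eq_sym (negbTE hj) expr0.
Qed.

Lemma sum_count_mem (I : finType) (vs : seq I) : (\sum_j count_mem j vs)%N = size vs.
Proof.
elim: vs => [|v vs IH]; first by rewrite big1.
rewrite /= big_split /= IH (bigD1 v) //= eqxx big1 ?addn0 // => j hj.
by rewrite eq_sym (negbTE hj).
Qed.

Lemma big_enum_cast (V : zmodType) (T : finType) (A : {set T}) m (e : #|A| = m) (F : T -> V) :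
  \sum_(i in A) F i = \sum_(k < m) F (enum_val (cast_ord (esym e) k)).
Proof. by case: m / e; rewrite big_enum_val; apply: eq_bigr => k _; rewrite cast_ord_id. Qed.

Section HomogeneousPolynomials.
Variables (R : realType) (n : nat).
Implicit Types (P Q : 'rV[R]_n -> R -> R) (t : 'rV[R]_n) (x : R).

(* A monomial is a triple (coefficient, multiset of variables t_v, power of x). *)
Definition homog2 (k : nat) P : Prop :=
  exists L : seq (R * seq 'I_n * nat),
    all (fun e => size e.1.2 + e.2 == k)%N L /\
    forall t x, P t x = \sum_(e <- L) e.1.1 * \prod_(v <- e.1.2) t 0 v * x ^+ e.2.

Lemma homog2_ext k P Q : homog2 k P -> (forall t x, P t x = Q t x) -> homog2 k Q.
Proof. by move=> [L [hL hP]] e; exists L; split=> // t x; rewrite -e. Qed.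

Lemma homog2_0 k : homog2 k (fun _ _ => 0).
Proof. by exists [::]; split=> // t x; rewrite big_nil. Qed.

Lemma homog2D k P Q : homog2 k P -> homog2 k Q -> homog2 k (fun t x => P t x + Q t x).
Proof.
move=> [L1 [h1 e1]] [L2 [h2 e2]]; exists (L1 ++ L2).
by rewrite all_cat h1 h2; split=> // t x; rewrite big_cat e1 e2.
Qed.

Lemma homog2Z k a P : homog2 k P -> homog2 k (fun t x => a * P t x).
Proof.
move=> [L [hL e]]; exists [seq (a * u.1.1, u.1.2, u.2) | u <- L].
rewrite all_map; split=> // t x; rewrite e big_map mulr_sumr.
by apply: eq_bigr => u _; rewrite !mulrA.
Qed.

Lemma homog2Zr k a P : homog2 k P -> homog2 k (fun t x => P t x * a).
Proof. by move/(homog2Z a)/homog2_ext; apply=> t x; rewrite mulrC. Qed.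

Lemma homog2M k1 k2 P Q :
  homog2 k1 P -> homog2 k2 Q -> homog2 (k1 + k2) (fun t x => P t x * Q t x).
Proof.
move=> [L1 [h1 e1]] [L2 [h2 e2]].
exists [seq (u.1.1 * v.1.1, u.1.2 ++ v.1.2, (u.2 + v.2)%N) | u <- L1, v <- L2].
split.
  apply/allP => z /allpairsP [[u v] /= [hu hv ->]] /=.
  rewrite size_cat -(eqP (allP h1 u hu)) -(eqP (allP h2 v hv)).
  by apply/eqP; ring.
move=> t x; rewrite e1 e2 big_allpairs_dep mulr_suml; apply: eq_bigr => u _.
by rewrite mulr_sumr; apply: eq_bigr => v _; rewrite big_cat exprD /=; ring.
Qed.

Lemma homog2_coord (j : 'I_n) : homog2 1 (fun t _ => t 0 j).
Proof.
exists [:: (1, [:: j], 0%N)]; split=> // t x.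
by rewrite big_seq1 /= big_seq1 mul1r mulr1.
Qed.

Lemma homog2_var : homog2 1 (fun _ x => x).
Proof.
exists [:: (1, [::], 1%N)]; split=> // t x.
by rewrite big_seq1 /= big_nil !mul1r expr1.
Qed.

Lemma homog2_sum k (I : Type) (r : seq I) (C : pred I) (F : I -> 'rV[R]_n -> R -> R) :
  (forall i, C i -> homog2 k (F i)) -> homog2 k (fun t x => \sum_(i <- r | C i) F i t x).
Proof.
move=> hF; elim: r => [|i r IH].
  by apply: homog2_ext (homog2_0 k) _ => t x; rewrite big_nil.
case Ci: (C i).
  by apply: homog2_ext (homog2D (hF i Ci) IH) _ => t x; rewrite big_cons Ci.
by apply: homog2_ext IH _ => t x; rewrite big_cons Ci.
Qed.

Lemma homog_poly_monomials k (L : seq (R * seq 'I_n)) (P : 'rV[R]_n -> R) :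
  all (fun e => size e.2 == k) L ->
  (forall t, P t = \sum_(e <- L) e.1 * \prod_(v <- e.2) t 0 v) -> homog_poly k P.
Proof.
move=> hL hP.
pose ex (vs : seq 'I_n) : {ffun 'I_n -> 'I_k.+1} := [ffun j => inord (count_mem j vs)].
have exE e : e \in L -> forall j, (ex e.2 j : nat) = count_mem j e.2.
  move=> he j; rewrite ffunE inordK // ltnS -(eqP (allP hL e he)) -sum_count_mem.
  by rewrite (bigD1 j) //= leq_addr.
exists (fun a => \sum_(e <- L | ex e.2 == a) e.1) => t.
under [RHS]eq_bigr => a _ do rewrite big_mkcond mulr_suml.
rewrite hP exchange_big /= big_seq_cond [RHS]big_seq_cond.
apply: eq_bigr => e /andP [he _].
rewrite (bigD1 (ex e.2)) /=; last first.
  apply/eqP; rewrite -[RHS](eqP (allP hL e he)) -sum_count_mem.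
  by apply: eq_bigr => j _; rewrite exE.
rewrite eqxx [X in _ = _ + X]big1 ?addr0; last first.
  by move=> a /andP [_ ha]; rewrite eq_sym (negbTE ha) mul0r.
by rewrite prod_count_mem; congr (_ * _); apply: eq_bigr => j _; rewrite exE.
Qed.

Lemma homog2_horner k P : homog2 k P ->
  exists2 L : seq (R * seq 'I_n * nat), all (fun e => size e.1.2 + e.2 == k)%N L &
    forall t, P t = horner (\sum_(e <- L) (e.1.1 * \prod_(v <- e.1.2) t 0 v) *: 'X^(e.2)).
Proof.
move=> [L [hL hP]]; exists L => // t; apply/funext => x.
by rewrite hP horner_sum; apply: eq_bigr => e _; rewrite hornerZ hornerXn.
Qed.

Lemma homog2_derive0 k P : homog2 k P ->
  (forall t, is_derive (0 : R) (1 : R) (P t) ('D_1 (P t) 0)) /\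
  homog_poly k.-1 (fun t => 'D_1 (P t) 0).
Proof.
move=> /homog2_horner [L hL hP].
have hD t := is_derive_poly (\sum_(e <- L) (e.1.1 * \prod_(v <- e.1.2) t 0 v) *: 'X^(e.2)) 0.
have DE t : 'D_1 (P t) 0 = \sum_(e <- L | e.2 == 1%N) e.1.1 * \prod_(v <- e.1.2) t 0 v.
  by rewrite hP (derive_val (is_derive := hD t)) horner_coef0 coef_deriv coef_sumMXn mulr1n.
split=> [t|]; first by rewrite hP (derive_val (is_derive := hD t)).
apply: (@homog_poly_monomials _ [seq (e.1.1, e.1.2) | e <- L & e.2 == 1%N]).
  rewrite all_map; apply/allP => e; rewrite mem_filter => /andP [/eqP e1 he] /=.
  by rewrite -(eqP (allP hL e he)) e1 addn1.
by move=> t; rewrite DE big_map big_filter.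
Qed.

Lemma homog_poly_derivable k (P : 'rV[R]_n -> R) t v :
  homog_poly k P -> derivable (fun tau : R => P (t + tau *: v)) 0 1.
Proof.
move=> [cf hP].
pose q : {poly R} := \sum_(a : {ffun 'I_n -> 'I_k.+1} | (\sum_(j < n) (a j : nat))%N == k)
   cf a *: \prod_(j < n) ((t 0 j)%:P + v 0 j *: 'X) ^+ a j.
have -> : (fun tau : R => P (t + tau *: v)) = horner q.
  apply/funext => tau; rewrite hP /q horner_sum; apply: eq_bigr => a _.
  rewrite hornerZ horner_prod; congr (_ * _); apply: eq_bigr => j _.
  by rewrite horner_exp !mxE hornerD hornerC hornerZ hornerX mulrC.
exact: (ex_derive (is_derive := is_derive_poly q 0)).
Qed.

End HomogeneousPolynomials.

Arguments homog2_0 {R n k}.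
Arguments homog2_coord {R n}.
Arguments homog2_var {R n}.

Section Calculus.
Variable R : realType.
Implicit Types (z w : R[i]) (a : R).

Lemma cRe_mul z w : cRe (z * w) = cRe z * cRe w - cIm z * cIm w.
Proof. by case: z => ? ?; case: w. Qed.

Lemma cIm_mul z w : cIm (z * w) = cRe z * cIm w + cIm z * cRe w.
Proof. by case: z => ? ?; case: w. Qed.

Lemma iC_iC a z : iC a * (iC a * z) = - (rC (a ^+ 2) * z).
Proof. by case: z => x y /=; congr Complex; ring. Qed.

Lemma cderive_cst z : cderive (fun _ : R => z) 0 = 0.
Proof. by rewrite /cderive !derive1E !derive_val. Qed.

Lemma cderive_expiM (th : R -> R) (ph : R) (h : R -> R[i]) :
  th 0 = 0 -> is_derive (0 : R) (1 : R) th ph ->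
  derivable (fun x => cRe (h x)) 0 1 -> derivable (fun x => cIm (h x)) 0 1 ->
  cderive (fun x => expi (th x) * h x) 0 = cderive h 0 + iC ph * h 0.
Proof.
move=> th0 dth /derivableP Dre /derivableP Dim.
have dcos := is_derive1_comp (is_derive_cos (th 0)) dth.
have dsin := is_derive1_comp (is_derive_sin (th 0)) dth.
rewrite /cderive !derive1E.
have -> : (fun x => cRe (expi (th x) * h x)) =
          ((cos \o th) * (fun x => cRe (h x)) - (sin \o th) * (fun x => cIm (h x)))%R.
  by apply/funext => x; rewrite cRe_mul.
have -> : (fun x => cIm (expi (th x) * h x)) =
          ((cos \o th) * (fun x => cIm (h x)) + (sin \o th) * (fun x => cRe (h x)))%R.
  by apply/funext => x; rewrite cIm_mul.
rewrite (derive_val (is_derive := is_deriveB (is_deriveM dcos Dre) (is_deriveM dsin Dim))).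
rewrite (derive_val (is_derive := is_deriveD (is_deriveM dcos Dim) (is_deriveM dsin Dre))).
rewrite /= th0 cos0 sin0; case: (h 0) => a b /=.
by congr Complex; rewrite /GRing.scale /=; ring.
Qed.

Lemma derivable_comb (A B : R -> R) a b :
  derivable A 0 1 -> derivable B 0 1 -> derivable (fun x => a * A x + b * B x) 0 1.
Proof.
move=> /derivableP hA /derivableP hB.
exact: (ex_derive (is_derive := is_deriveD (is_deriveZ a hA) (is_deriveZ b hB))).
Qed.

Lemma lf0 d (l : 'rV[R]_d) : lf l 0 = 0.
Proof. by rewrite /lf big1 // => i _; rewrite mxE mul0r. Qed.

Lemma lf_comb d (l1 l2 y : 'rV[R]_d) a b : lf (a *: l1 + b *: l2) y = a * lf l1 y + b * lf l2 y.
Proof. by rewrite /lf !mulr_sumr -big_split; apply: eq_bigr => i _; rewrite !mxE /=; ring. Qed.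

Lemma is_derive_lf_comb d (G : R -> 'rV[R]_d) (l1 l2 : 'rV[R]_d) a b d1 d2 :
  is_derive (0 : R) (1 : R) (fun x => lf l1 (G x)) d1 ->
  is_derive (0 : R) (1 : R) (fun x => lf l2 (G x)) d2 ->
  is_derive (0 : R) (1 : R) (fun x => lf (a *: l1 + b *: l2) (G x)) (a * d1 + b * d2).
Proof.
move=> h1 h2; have -> : (fun x => lf (a *: l1 + b *: l2) (G x)) =
    (a \*: (fun x => lf l1 (G x)) + b \*: (fun x => lf l2 (G x)))%R.
  by apply/funext => x; rewrite lf_comb.
exact: is_deriveD.
Qed.

Definition derivable_along n (j : 'I_n) (g : 'rV[R]_n -> R[i]) : Prop :=
  forall t, derivable (fun tau : R => cRe (g (t + tau *: delta_mx 0 j))) 0 1 /\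
            derivable (fun tau : R => cIm (g (t + tau *: delta_mx 0 j))) 0 1.

Lemma smooth_derivable_along n (f : 'rV[R]_n -> R[i]) j :
  smooth f -> derivable_along j f /\ derivable_along j (partial j f).
Proof.
by move=> hf; split=> t; [have [_ _] := hf [::] | have [_ _] := hf [:: j]]; apply.
Qed.

Lemma cRe_Dphi n j (ph : 'rV[R]_n -> R) f u :
  cRe (Dphi j ph f u) = cRe (partial j f u) - ph u * cIm (f u).
Proof. by rewrite /Dphi; case: (partial j f u) => ? ?; case: (f u) => ? ? /=; ring. Qed.

Lemma cIm_Dphi n j (ph : 'rV[R]_n -> R) f u :
  cIm (Dphi j ph f u) = cIm (partial j f u) + ph u * cRe (f u).
Proof. by rewrite /Dphi; case: (partial j f u) => ? ?; case: (f u) => ? ? /=; ring. Qed.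

Lemma derivable_along_Dphi n (j : 'I_n) (ph : 'rV[R]_n -> R) (f : 'rV[R]_n -> R[i]) :
  (forall t, derivable (fun tau : R => ph (t + tau *: delta_mx 0 j)) 0 1) ->
  derivable_along j f -> derivable_along j (partial j f) -> derivable_along j (Dphi j ph f).
Proof.
move=> hph hf hpf t; have [f1 f2] := hf t; have [pf1 pf2] := hpf t; split.
  have -> : (fun tau : R => cRe (Dphi j ph f (t + tau *: delta_mx 0 j))) =
    ((fun tau => cRe (partial j f (t + tau *: delta_mx 0 j))) -
     (fun tau => ph (t + tau *: delta_mx 0 j)) * (fun tau => cIm (f (t + tau *: delta_mx 0 j))))%R.
    by apply/funext => tau; rewrite cRe_Dphi.
  exact: derivableB pf1 (derivableM (hph t) f2).
have -> : (fun tau : R => cIm (Dphi j ph f (t + tau *: delta_mx 0 j))) =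
  ((fun tau => cIm (partial j f (t + tau *: delta_mx 0 j))) +
   (fun tau => ph (t + tau *: delta_mx 0 j)) * (fun tau => cRe (f (t + tau *: delta_mx 0 j))))%R.
  by apply/funext => tau; rewrite cIm_Dphi.
exact: derivableD pf2 (derivableM (hph t) f1).
Qed.

End Calculus.

Section BakerCampbellHausdorff.
Variables (R : realType) (d : nat) (c : 'I_d -> 'I_d -> 'rV[R]_d).
Implicit Types (x y : 'rV[R]_d).

Lemma br_entry x y k : br c x y 0 k = \sum_i \sum_j x 0 i * y 0 j * c i j 0 k.
Proof.
rewrite /br summxE; apply: eq_bigr => i _; rewrite summxE.
by apply: eq_bigr => j _; rewrite mxE.
Qed.

Lemma br_delta i j : br c (delta_mx 0 i) (delta_mx 0 j) = c i j.
Proof.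
apply/rowP => k; rewrite br_entry (bigD1 i) //= [X in _ + X]big1 => [|a hai]; last first.
  by apply: big1 => b _; rewrite !mxE (negbTE hai) andbF !mul0r.
rewrite addr0 (bigD1 j) //= [X in _ + X]big1 => [|b hbj]; last first.
  by rewrite !mxE (negbTE hbj) andbF mulr0 mul0r.
by rewrite !mxE !eqxx !mul1r addr0.
Qed.

Lemma br_scale a b x y : br c (a *: x) (b *: y) = (a * b) *: br c x y.
Proof.
apply/rowP => k; rewrite mxE !br_entry mulr_sumr; apply: eq_bigr => i _.
by rewrite mulr_sumr; apply: eq_bigr => j _; rewrite !mxE; ring.
Qed.

Lemma br_x0 x : br c x 0 = 0.
Proof. by have := br_scale 1 0 x 0; rewrite scale0r mulr0 !scale0r scale1r. Qed.

Lemma nest_collinear x a w :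
  br c x x = 0 -> (1 < size w)%N -> nest c x (a *: x) w = 0.
Proof.
move=> hxx; elim: w => [|l [|l' [|l'' w]] IH] // _.
  have sx b : (if b then x else a *: x) = (if b then 1 else a) *: x.
    by case: b; rewrite ?scale1r.
  by rewrite /= !sx br_scale hxx scaler0.
by have /= -> := IH isT; rewrite br_x0.
Qed.

Variable K : nat.
Hypothesis K_gt0 : (0 < K)%N.

Lemma size_dyn_word k (rs : {ffun 'I_k -> 'I_K.+1 * 'I_K.+1}) :
  size (dyn_word rs) = dyn_tot rs.
Proof.
rewrite /dyn_word /dyn_tot size_flatten /shape -map_comp sumnE big_map big_enum.
by apply: eq_bigr => i _; rewrite /= size_cat !size_nseq.
Qed.

Lemma dyn_tot_ge k (rs : {ffun 'I_k -> 'I_K.+1 * 'I_K.+1}) : dyn_ok rs -> (k <= dyn_tot rs)%N.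
Proof.
case/andP => /forallP h _; rewrite -[X in (X <= _)%N]card_ord -sum1_card.
exact: leq_sum.
Qed.

Definition dyn_coef k (rs : {ffun 'I_k.+1 -> 'I_K.+1 * 'I_K.+1}) : R :=
  ((dyn_tot rs)%:R * \prod_(i < k.+1) (((rs i).1)`! * ((rs i).2)`!)%:R)^-1.

Definition bch_higher x y : 'rV[R]_d :=
  \sum_(k < K) (((-1) ^+ k / (k.+1)%:R) *:
     \sum_(rs : {ffun 'I_k.+1 -> 'I_K.+1 * 'I_K.+1} | dyn_ok rs && (1 < size (dyn_word rs))%N)
        dyn_coef rs *: nest c x y (dyn_word rs)).

Definition dyn_letter (b : bool) : {ffun 'I_1 -> 'I_K.+1 * 'I_K.+1} :=
  [ffun => (inord b, inord (~~ b))].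

Lemma val_inord_bool (b : bool) : (inord b : 'I_K.+1) = b :> nat.
Proof. by rewrite inordK // ltnS; case: b. Qed.

Lemma dyn_letterE b : dyn_word (dyn_letter b) = [:: b] /\ dyn_tot (dyn_letter b) = 1%N.
Proof.
rewrite /dyn_word /dyn_tot enum_ordSl enum_ord0 big_ord1 /= !ffunE /= !val_inord_bool.
by case: b.
Qed.

Lemma dyn_ok_letter b : dyn_ok (dyn_letter b).
Proof.
rewrite /dyn_ok (dyn_letterE b).2 K_gt0 andbT.
by apply/forallP => i; rewrite ffunE /= !val_inord_bool; case: b.
Qed.

Lemma dyn_short_word (rs : {ffun 'I_1 -> 'I_K.+1 * 'I_K.+1}) :
  dyn_ok rs && ~~ (1 < size (dyn_word rs))%N = (rs \in [set dyn_letter true; dyn_letter false]).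
Proof.
apply/idP/idP => [/andP [ok]|].
  rewrite size_dyn_word -leqNgt => /(conj (dyn_tot_ge ok)) /andP.
  rewrite -eqn_leq /dyn_tot big_ord1 !inE => tot1.
  suff -> : rs = dyn_letter (val (rs ord0).1 == 1)%N.
    by case: (val (rs ord0).1 == 1)%N; rewrite eqxx ?orbT.
  apply/ffunP => i; rewrite !ffunE (_ : i = ord0); last exact: ord1.
  case: (rs ord0) tot1 => a b /= tot1; congr pair; apply: val_inj;
    rewrite /= inordK; lia.
by rewrite !inE => /orP [] /eqP ->; rewrite dyn_ok_letter (dyn_letterE _).1.
Qed.

Lemma bch_degree1 x y :
  \sum_(k < K) (((-1) ^+ k / (k.+1)%:R) *:
     \sum_(rs : {ffun 'I_k.+1 -> 'I_K.+1 * 'I_K.+1} | dyn_ok rs && ~~ (1 < size (dyn_word rs))%N)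
        dyn_coef rs *: nest c x y (dyn_word rs)) = x + y.
Proof.
rewrite (bigD1 (Ordinal K_gt0)) //= [X in _ + X]big1 ?addr0 => [|k /eqP hk]; last first.
  rewrite big1 ?scaler0 // => rs /andP [ok]; rewrite size_dyn_word.
  by rewrite (leq_trans _ (dyn_tot_ge ok)) // ltnS lt0n; apply/eqP => k0; apply/hk/val_inj.
rewrite expr0 div1r invr1 scale1r; under eq_bigl => rs do rewrite dyn_short_word.
rewrite big_setU1 ?big_set1 /=; last first.
  by rewrite inE; apply/eqP => /(congr1 (@dyn_word K 1)); rewrite !(dyn_letterE _).1.
rewrite /dyn_coef !(dyn_letterE _).1 !(dyn_letterE _).2 !big_ord1 !ffunE !val_inord_bool.
by rewrite /= !mul1r invr1 !scale1r.
Qed.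

Lemma bch_split x y : bch c K x y = x + y + bch_higher x y.
Proof.
rewrite -(bch_degree1 x y) addrC /bch /bch_higher -big_split /=; apply: eq_bigr => k _.
by rewrite -scalerDr (bigID (fun rs => (1 < size (dyn_word rs))%N)).
Qed.

Lemma bch_collinear x a : br c x x = 0 -> bch c K x (a *: x) = x + a *: x.
Proof.
move=> hxx; rewrite bch_split /bch_higher big1 ?addr0 // => k _.
by rewrite big1 ?scaler0 // => rs /andP [_ hw]; rewrite nest_collinear ?scaler0.
Qed.

End BakerCampbellHausdorff.

Section GradedLieAlgebra.
Variables (R : realType) (d : nat) (c : 'I_d -> 'I_d -> 'rV[R]_d) (deg : 'I_d -> nat).
Hypothesis br_graded : forall (a b : nat) x y,
  inV deg a x -> inV deg b y -> inV deg (a + b) (br c x y).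
Hypothesis deg_gt0 : forall i, (0 < deg i)%N.
Implicit Types (x y u v : 'rV[R]_d).

Lemma inV_delta i : inV deg (deg i) (delta_mx 0 i : 'rV[R]_d).
Proof.
apply/forallP => k; apply/implyP => hk; rewrite mxE.
by have /negbTE -> : k != i by apply: contraNneq hk => ->.
Qed.

Lemma inV_sum j (I : Type) (r : seq I) (P : pred I) (F : I -> 'rV[R]_d) :
  (forall i, P i -> inV deg j (F i)) -> inV deg j (\sum_(i <- r | P i) F i).
Proof.
move=> hF; apply/forallP => k; apply/implyP => hk; rewrite summxE.
by apply/eqP/big1 => i Pi; have /forallP /(_ k) /implyP /(_ hk) /eqP := hF i Pi.
Qed.

Lemma inVZ j a x : inV deg j x -> inV deg j (a *: x).
Proof.
move=> /forallP hx; apply/forallP => k; apply/implyP => hk.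
by rewrite mxE (eqP (implyP (hx k) hk)) mulr0.
Qed.

Lemma proj1_V1 v : inV deg 1 v -> proj1 deg v = v.
Proof.
move=> /forallP hv; apply/rowP => i; rewrite mxE; case: eqP => // /eqP hi.
by rewrite (eqP (implyP (hv i) hi)).
Qed.

Lemma struct_const_deg i j k : deg k != (deg i + deg j)%N -> c i j 0 k = 0.
Proof.
move=> hk; have := br_graded (inV_delta i) (inV_delta j).
by rewrite br_delta => /forallP /(_ k) /implyP /(_ hk) /eqP.
Qed.

Lemma proj1_br u v : proj1 deg (br c u v) = 0.
Proof.
apply/rowP => k; rewrite !mxE; case: eqP => // hk.
rewrite br_entry big1 // => i _; rewrite big1 // => j _.
rewrite struct_const_deg ?mulr0 // hk.
by have := deg_gt0 i; have := deg_gt0 j; case: (deg i) => [|[|]]; case: (deg j).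
Qed.

Lemma proj1_nest x y w : (1 < size w)%N -> proj1 deg (nest c x y w) = 0.
Proof. by case: w => [|b [|b' w]] // _; apply: proj1_br. Qed.

Lemma proj1_bch_higher K x y : proj1 deg (bch_higher c K x y) = 0.
Proof.
apply/rowP => k; rewrite !mxE; case: eqP => // hk.
rewrite summxE big1 // => l _; rewrite mxE summxE big1 ?mulr0 // => rs /andP [_ hw].
have := congr1 (fun z : 'rV[R]_d => z 0 k) (proj1_nest x y hw).
by rewrite !mxE hk eqxx => ->; rewrite mulr0.
Qed.

Lemma proj1_bch K x y : (0 < K)%N -> proj1 deg (bch c K x y) = proj1 deg x + proj1 deg y.
Proof.
move=> K_gt0; rewrite bch_split //; apply/rowP => k.
have := congr1 (fun z : 'rV[R]_d => z 0 k) (proj1_bch_higher K x y).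
by rewrite !mxE; case: eqP => // _ ->; rewrite addr0.
Qed.

Variable n : nat.
Implicit Types (G H : 'rV[R]_n -> R -> 'rV[R]_d).

Definition graded_poly G := forall k, homog2 (deg k) (fun t tau => G t tau 0 k).

Lemma graded_poly_ext G H : graded_poly G -> (forall t tau, G t tau = H t tau) -> graded_poly H.
Proof. by move=> hG e k; apply: homog2_ext (hG k) _ => t tau; rewrite e. Qed.

Lemma graded_poly0 : graded_poly (fun _ _ => 0).
Proof. by move=> k; apply: homog2_ext homog2_0 _ => t tau; rewrite mxE. Qed.

Lemma graded_polyZ a G : graded_poly G -> graded_poly (fun t tau => a *: G t tau).
Proof. by move=> hG k; apply: homog2_ext (homog2Z a (hG k)) _ => t tau; rewrite mxE. Qed.

Lemma graded_polyN G : graded_poly G -> graded_poly (fun t tau => - G t tau).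
Proof. by move/(graded_polyZ (-1))/graded_poly_ext; apply=> t tau; rewrite scaleN1r. Qed.

Lemma graded_poly_sum (I : Type) (r : seq I) (P : pred I) (F : I -> 'rV[R]_n -> R -> 'rV[R]_d) :
  (forall i, P i -> graded_poly (F i)) -> graded_poly (fun t tau => \sum_(i <- r | P i) F i t tau).
Proof.
move=> hF k; apply: homog2_ext (homog2_sum r (fun i Pi => hF i Pi k)) _ => t tau.
by rewrite summxE.
Qed.

Lemma graded_poly_V1 (a : 'rV[R]_n -> R -> R) v :
  homog2 1 a -> inV deg 1 v -> graded_poly (fun t tau => a t tau *: v).
Proof.
move=> ha /forallP hv k; have [hk|hk] := eqVneq (deg k) 1%N.
  by rewrite hk; apply: homog2_ext (homog2Zr (v 0 k) ha) _ => t tau; rewrite mxE.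
apply: homog2_ext homog2_0 _ => t tau.
by rewrite mxE (eqP (implyP (hv k) hk)) mulr0.
Qed.

Lemma graded_poly_br G H : graded_poly G -> graded_poly H ->
  graded_poly (fun t tau => br c (G t tau) (H t tau)).
Proof.
move=> hG hH k; apply: homog2_ext _ (fun t tau => esym (br_entry c _ _ k)).
apply: homog2_sum => i _; apply: homog2_sum => j _.
have [->|hk] := eqVneq (deg k) (deg i + deg j)%N.
  exact/homog2Zr/homog2M.
apply: homog2_ext homog2_0 _ => t tau.
by rewrite struct_const_deg ?mulr0.
Qed.

Lemma graded_poly_nest G H w : graded_poly G -> graded_poly H ->
  graded_poly (fun t tau => nest c (G t tau) (H t tau) w).
Proof.
move=> hG hH; elim: w => [|b w IH] /=; first exact: graded_poly0.
have hGH : graded_poly (fun t tau => if b then G t tau else H t tau) by case: b.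
by case: w IH => [|b' w] IH //; apply: graded_poly_br.
Qed.

Lemma graded_poly_bch K G H : graded_poly G -> graded_poly H ->
  graded_poly (fun t tau => bch c K (G t tau) (H t tau)).
Proof.
move=> hG hH; apply: graded_poly_sum => k _; apply: graded_polyZ.
by apply: graded_poly_sum => rs _; apply/graded_polyZ/graded_poly_nest.
Qed.

Lemma homog2_lf (l : 'rV[R]_d) e G : graded_poly G ->
  (forall k, deg k != e -> l 0 k = 0) -> homog2 e (fun t tau => lf l (G t tau)).
Proof.
move=> hG hl; apply: homog2_sum => k _.
have [<-|hk] := eqVneq (deg k) e; first exact: homog2Zr.
by apply: homog2_ext homog2_0 _ => t tau; rewrite hl ?mulr0.
Qed.

Section InducedRepresentation.
Variables (K p : nat) (X : 'I_p -> 'rV[R]_d) (S : {set 'I_p}) (Y : 'I_n -> 'I_p).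
Hypothesis K_gt0 : (0 < K)%N.
Hypothesis X_basis : is_basis_of (inV deg 1) X.
Hypothesis Y_inj : injective Y.
Hypothesis S_Y : forall k, k \in S <-> exists j, Y j = k.
Hypothesis br_alt : forall x, br c x x = 0.
Implicit Types (l nu : 'rV[R]_d) (i : 'I_p) (j : 'I_n) (t w : 'rV[R]_n) (f g : 'rV[R]_n -> R[i]).

Lemma S_imset : S = Y @: [set: 'I_n].
Proof.
apply/setP => k; apply/idP/imsetP => [/S_Y [j <-]|[j _ ->]]; first by exists j.
by apply/S_Y; exists j.
Qed.

Lemma big_S (V : zmodType) (F : 'I_p -> V) : \sum_(k in S) F k = \sum_j F (Y j).
Proof.
by rewrite S_imset big_imset /=; [apply: eq_bigl => j; rewrite inE | move=> ? ? _ _ /Y_inj].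
Qed.

Lemma card_notin_S : #|~: S| = (p - n)%N.
Proof.
have card_S : #|S| = n by rewrite S_imset card_imset ?cardsT ?card_ord //; apply: Y_inj.
by have := cardsC S; rewrite card_ord card_S => h; rewrite -[in RHS]h addKn.
Qed.

Lemma eS_coef t : eS X Y t = \sum_k (\sum_j (Y j == k)%:R * t 0 j) *: X k.
Proof.
under eq_bigr => k _ do rewrite scaler_suml.
rewrite exchange_big /=; apply: eq_bigr => j _.
rewrite (bigD1 (Y j)) //= eqxx mul1r big1 ?addr0 // => k hk.
by rewrite eq_sym (negbTE hk) mul0r scale0r.
Qed.

Lemma aS_V1 (u : 'I_p -> R) : aS c deg K X S Y (\sum_k u k *: X k) = \row_j u (Y j).
Proof.
have [X_V1 X_free _] := X_basis.
set a := \sum_k u k *: X k.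
have a_V1 : inV deg 1 a by apply: inV_sum => k _; apply: inVZ.
have proj1E t : proj1 deg (bch c K (- eS X Y t) a) = a - eS X Y t.
  rewrite proj1_bch // !proj1_V1 // 1?addrC // -scaleN1r.
  by apply/inVZ/inV_sum => j _; apply: inVZ.
pose t0 : 'rV[R]_n := \row_j u (Y j).
have in_h_t0 : in_h deg X S (bch c K (- eS X Y t0) a).
  exists u; rewrite proj1E /a (bigID (mem S)) /= big_S addrAC.
  by rewrite [A in A - _](_ : _ = eS X Y t0) ?subrr ?add0r //; apply: eq_bigr => j _; rewrite mxE.
have in_h_uniq t : in_h deg X S (bch c K (- eS X Y t) a) -> t = t0.
  case=> b; rewrite proj1E => hb.
  pose co k := u k - \sum_j (Y j == k)%:R * t 0 j - (if k \in S then 0 else b k).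
  have co0 : \sum_k co k *: X k = 0.
    under eq_bigr => k _ do rewrite /co !scalerBl.
    rewrite !sumrB -/a -eS_coef hb big_mkcond; apply/eqP; rewrite subr_eq0.
    by apply/eqP/eq_bigr => k _; case: (k \in S); rewrite ?scale0r.
  apply/rowP => j; have /eqP := X_free _ co0 (Y j).
  rewrite /co (bigD1 j) //= eqxx mul1r big1 ?addr0 => [|j' hj']; last first.
    by rewrite (inj_eq Y_inj) (negbTE hj') mul0r.
  have -> : Y j \in S by apply/S_Y; exists j.
  by rewrite subr0 subr_eq0 mxE => /eqP.
rewrite /aS; case: pselect => [h|[]]; last by exists t0.
exact/in_h_uniq/(projT2 (cid h)).
Qed.

Lemma aS_scale i tau : aS c deg K X S Y (tau *: X i) = \row_j (tau * (Y j == i)%:R).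
Proof.
suff -> : tau *: X i = \sum_k (tau * (k == i)%:R) *: X k by rewrite aS_V1.
rewrite (bigD1 i) //= eqxx mulr1 big1 ?addr0 // => k hk.
by rewrite (negbTE hk) mulr0 scale0r.
Qed.

Lemma aS_scale_Y j tau : aS c deg K X S Y (tau *: X (Y j)) = tau *: delta_mx 0 j.
Proof.
rewrite aS_scale; apply/rowP => j'; rewrite !mxE (inj_eq Y_inj) eq_sym.
by case: (j == j'); rewrite ?mulr1 ?mulr0.
Qed.

Lemma aS_scale_notin i tau : i \notin S -> aS c deg K X S Y (tau *: X i) = 0.
Proof.
move=> hi; rewrite aS_scale; apply/rowP => j; rewrite !mxE.
case: eqP => [hj|_]; last by rewrite mulr0.
by case/negP: hi; apply/S_Y; exists j.
Qed.

Definition phase i t tau : 'rV[R]_d :=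
  bch c K (bch c K (eS X Y t) (tau *: X i)) (- eS X Y (t + aS c deg K X S Y (tau *: X i))).

Lemma pi_scale nu i tau g t : Defs.pi c deg K X S Y nu (tau *: X i) g t =
  expi (lf nu (phase i t tau)) * g (t + aS c deg K X S Y (tau *: X i)).
Proof. by []. Qed.

Lemma graded_poly_phase i : graded_poly (phase i).
Proof.
have [X_V1 _ _] := X_basis.
have eS_poly (a : 'I_n -> 'rV[R]_n -> R -> R) : (forall j, homog2 1 (a j)) ->
    graded_poly (fun t tau => \sum_j a j t tau *: X (Y j)).
  by move=> ha; apply: graded_poly_sum => j _; apply: graded_poly_V1.
apply: graded_poly_bch; first apply: graded_poly_bch.
- exact: (eS_poly (fun j t (_ : R) => t 0 j) homog2_coord).
- exact: graded_poly_V1 homog2_var (X_V1 i).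
apply: graded_polyN.
apply: graded_poly_ext (eS_poly (fun j t tau => t 0 j + (Y j == i)%:R * tau) _) _.
  by move=> j; apply: homog2D (homog2_coord j) (homog2Z _ homog2_var).
by move=> t tau; rewrite aS_scale; apply: eq_bigr => j _; rewrite !mxE mulrC.
Qed.

Lemma phase0 i t : phase i t 0 = 0.
Proof.
rewrite /phase aS_scale (_ : \row_j _ = 0); last by apply/rowP => j; rewrite !mxE mul0r.
rewrite addr0 scale0r -(scale0r (eS X Y t)) bch_collinear //.
by rewrite scale0r addr0 -scaleN1r bch_collinear // scaleN1r subrr.
Qed.

Definition phase_coef l i t : R := 'D_1 (fun tau => lf l (phase i t tau)) 0.

Lemma phase_coef_homog l e i : (forall k, deg k != e.+1 -> l 0 k = 0) ->
  (forall t, is_derive (0 : R) (1 : R) (fun tau => lf l (phase i t tau)) (phase_coef l i t)) /\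
  homog_poly e (phase_coef l i).
Proof. by move=> hl; apply: homog2_derive0 (homog2_lf (graded_poly_phase i) hl). Qed.

Lemma dpi_Y nu j g t ph :
  is_derive (0 : R) (1 : R) (fun tau => lf nu (phase (Y j) t tau)) ph ->
  derivable (fun tau : R => cRe (g (t + tau *: delta_mx 0 j))) 0 1 ->
  derivable (fun tau : R => cIm (g (t + tau *: delta_mx 0 j))) 0 1 ->
  dpi c deg K X S Y nu (X (Y j)) g t = partial j g t + iC ph * g t.
Proof.
move=> hph g1 g2; rewrite /dpi.
have -> : (fun tau => Defs.pi c deg K X S Y nu (tau *: X (Y j)) g t) =
    (fun tau => expi (lf nu (phase (Y j) t tau)) * g (t + tau *: delta_mx 0 j)).
  by apply/funext => tau; rewrite pi_scale aS_scale_Y.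
by rewrite cderive_expiM ?phase0 ?lf0 // scale0r addr0.
Qed.

Lemma dpi_notin nu i g t ph : i \notin S ->
  is_derive (0 : R) (1 : R) (fun tau => lf nu (phase i t tau)) ph ->
  dpi c deg K X S Y nu (X i) g t = iC ph * g t.
Proof.
move=> hi hph; rewrite /dpi.
have -> : (fun tau => Defs.pi c deg K X S Y nu (tau *: X i) g t) =
    (fun tau => expi (lf nu (phase i t tau)) * (fun _ => g t) tau).
  by apply/funext => tau; rewrite pi_scale aS_scale_notin // addr0.
by rewrite cderive_expiM ?phase0 ?lf0 ?cderive_cst ?add0r //; apply: derivable_cst.
Qed.

Lemma dpiL_formula nu (ph : 'I_p -> 'rV[R]_n -> R) f t :
  (forall i w, is_derive (0 : R) (1 : R) (fun tau => lf nu (phase i w tau)) (ph i w)) ->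
  (forall i j w, derivable (fun tau : R => ph i (w + tau *: delta_mx 0 j)) 0 1) ->
  smooth f ->
  dpiL c deg K X S Y nu f t =
    \sum_j Dphi j (ph (Y j)) (Dphi j (ph (Y j)) f) t - \sum_(i in ~: S) rC (ph i t ^+ 2) * f t.
Proof.
move=> hph ph_der f_smooth.
have dpiY j g : derivable_along j g -> dpi c deg K X S Y nu (X (Y j)) g = Dphi j (ph (Y j)) g.
  by move=> hg; apply/funext => w; have [g1 g2] := hg w; apply: dpi_Y.
have dpiNS i g : i \notin S -> dpi c deg K X S Y nu (X i) g = fun w => iC (ph i w) * g w.
  by move=> hi; apply/funext => w; apply: dpi_notin.
rewrite /dpiL (bigID (mem S)) /= big_S -sumrN; congr (_ + _).
  apply: eq_bigr => j _; have [f1 f2] := smooth_derivable_along j f_smooth.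
  by rewrite (dpiY j f) // dpiY //; apply: derivable_along_Dphi.
by apply: eq_big => [i|i hi]; rewrite ?inE // !dpiNS // iC_iC.
Qed.

Lemma dpiL_comb l1 l2 e1 e2 lam1 lam2 f t :
  (forall k, deg k != e1.+1 -> l1 0 k = 0) -> (forall k, deg k != e2.+1 -> l2 0 k = 0) ->
  smooth f ->
  dpiL c deg K X S Y (lam1 *: l1 + lam2 *: l2) f t =
    \sum_j Dphi j (fun w => lam1 * phase_coef l1 (Y j) w + lam2 * phase_coef l2 (Y j) w)
      (Dphi j (fun w => lam1 * phase_coef l1 (Y j) w + lam2 * phase_coef l2 (Y j) w) f) t
    - \sum_(i in ~: S) rC ((lam1 * phase_coef l1 i t + lam2 * phase_coef l2 i t) ^+ 2) * f t.
Proof.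
move=> hl1 hl2 f_smooth.
pose ph i w := lam1 * phase_coef l1 i w + lam2 * phase_coef l2 i w.
apply: (dpiL_formula (ph := ph)) => // [i w|i j w].
  exact: is_derive_lf_comb ((phase_coef_homog i hl1).1 w) ((phase_coef_homog i hl2).1 w).
apply: derivable_comb; apply: homog_poly_derivable.
  exact: (phase_coef_homog i hl1).2.
exact: (phase_coef_homog i hl2).2.
Qed.

End InducedRepresentation.

End GradedLieAlgebra.

Unset Implicit Arguments.
Theorem theorem2p1
  (R : realType)
  (* the stratified Lie algebra n = R^d, with structure constants c and grading deg *)
  (d : nat) (c : 'I_d -> 'I_d -> 'rV[R]_d) (deg : 'I_d -> nat) (m s : nat)
  (hm : (1 <= m)%N) (hs : (s < m)%N)
  (hlie : lie_algebra c) (hstrat : stratified c deg m)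
  (* basis B = {X_1..X_p} of V_1 *)
  (p : nat) (X : 'I_p -> 'rV[R]_d) (hX : is_basis_of (inV deg 1) X)
  (* l1: dual to the basis Z1 of V_(s+1) at index alpha *)
  (q1 : nat) (Z1 : 'I_q1 -> 'rV[R]_d) (alpha : 'I_q1) (l1 : 'rV[R]_d)
  (hZ1 : is_basis_of (inV deg s.+1) Z1)
  (hl1V : forall i, deg i != s.+1 -> l1 0 i = 0)
  (hl1Z : forall j, lf l1 (Z1 j) = (j == alpha)%:R)
  (* l2: dual to the basis Z2 of V_(m+1) at index beta *)
  (q2 : nat) (Z2 : 'I_q2 -> 'rV[R]_d) (beta : 'I_q2) (l2 : 'rV[R]_d)
  (hZ2 : is_basis_of (inV deg m.+1) Z2)
  (hl2V : forall i, deg i != m.+1 -> l2 0 i = 0)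
  (hl2Z : forall j, lf l2 (Z2 j) = (j == beta)%:R)
  (* l_i([V_k, V_j]) = 0 for k, j >= 2 *)
  (hl1br : forall (k j : nat) x y, (2 <= k)%N -> (2 <= j)%N ->
             inV deg k x -> inV deg j y -> lf l1 (br c x y) = 0)
  (hl2br : forall (k j : nat) x y, (2 <= k)%N -> (2 <= j)%N ->
             inV deg k x -> inV deg j y -> lf l2 (br c x y) = 0)
  (* the sets S_1, S_2 *)
  (S1 S2 : {set 'I_p})
  (hS1 : if s == 1%N then greedy_output c X l1 S1
         else if m == 1%N then S1 = finset.set0
         else support_set c X l1 S1)
  (hS2 : if m == 1%N then greedy_output c X l2 S2
         else support_set c X l2 S2)
  (* an enumeration Y_1..Y_n of S = S_1 u S_2 *)
  (n : nat) (Y : 'I_n -> 'I_p) (hYinj : injective Y)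
  (hYS : forall k, k \in S1 :|: S2 <-> exists j, Y j = k)
  (* lambda = lam1 l1 + lam2 l2 *)
  (lam1 lam2 : R) (hlam1 : lam1 != 0) (hlam2 : lam2 != 0) :
  exists (pt qt : 'I_n -> 'rV[R]_n -> R) (pp qq : 'I_(p - n) -> 'rV[R]_n -> R),
    [/\ forall j, homog_poly s (pt j),
        forall j, homog_poly m (qt j),
        forall k, homog_poly s (pp k),
        forall k, homog_poly m (qq k) &
        forall f : 'rV[R]_n -> R[i], smooth f ->
          forall t : 'rV[R]_n,
            dpiL c deg m.+1 X (S1 :|: S2) Y (lam1 *: l1 + lam2 *: l2) f t =
              \sum_(j < n)
                 Dphi j (fun u => lam1 * pt j u + lam2 * qt j u)
                   (Dphi j (fun u => lam1 * pt j u + lam2 * qt j u) f) t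
              - \sum_(k < p - n) rC ((lam2 * qq k t + lam1 * pp k t) ^+ 2) * f t].
Proof.
have [deg_bound br_gr _] := hstrat.
have deg_gt0 i : (0 < deg i)%N by case/andP: (deg_bound i).
have K_gt0 : (0 < m.+1)%N by [].
set S := S1 :|: S2.
have homog (l : 'rV[R]_d) e i (hl : forall k, deg k != e.+1 -> l 0 k = 0) :=
  (phase_coef_homog br_gr deg_gt0 K_gt0 hX hYinj hYS i hl).2.
pose P l i := phase_coef c deg m.+1 X S Y l i.
pose nS k := enum_val (cast_ord (esym (card_notin_S hYinj hYS)) k).
exists (fun j => P l1 (Y j)), (fun j => P l2 (Y j)), (fun k => P l1 (nS k)), (fun k => P l2 (nS k)).
split=> [j|j|k|k|f f_smooth t]; try exact: homog.
rewrite (dpiL_comb br_gr deg_gt0 K_gt0 hX hYinj hYS hlie.1 lam1 lam2 t hl1V hl2V f_smooth).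
rewrite (big_enum_cast (card_notin_S hYinj hYS)).
by congr (_ - _); apply: eq_bigr => k _; rewrite addrC.
Qed.
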